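(* Let $n=3$. For every $\varepsilon>0$ there is a constant $C_\varepsilon$, depending only on $\varepsilon$, such that for every finite field $F$ of characteristic $>2$ in which $-1$ is not a square, the paraboloid $$S=\{(\xi,\xi\cdot\xi):\xi\in F^{2}\}\subset F^3$$ satisfies $R^*_S(8/5\to 4)\le C_\varepsilon|F|^{\varepsilon}$.
   Context: $F$ is a finite field of characteristic $>2$, and $e:F\to S^1\subset\mathbb{C}$ is a fixed non-principal character, i.e. $e(x+y)=e(x)e(y)$ and $e$ is not identically $1$ (constants are uniform in the choice of $e$). $x\cdot\xi=\sum_i x_i\xi_i$ on $F^m$ for any $m$. For a nonempty set $S\subset F^n$ of frequencies, $d\sigma$ is the normalized counting measure on $S$, so $\|g\|_{L^p(S,d\sigma)}=\left(\frac1{|S|}\sum_{\xi\in S}|g(\xi)|^p\right)^{1/p}$, and for $g:S\to\mathbb{C}$ one defines $(g\,d\sigma)^\vee(x)=\frac1{|S|}\sum_{\xi\in S}g(\xi)e(x\cdot\xi)$ for $x\in F^n$. $L^q(F^n,dx)$ is taken with respect to counting measure. For $1\le p,q\le\infty$, $R^*_S(p\to q)$ is the smallest constant such that $\|(g\,d\sigma)^\vee\|_{L^q(F^n,dx)}\le R^*_S(p\to q)\,\|g\|_{L^p(S,d\sigma)}$ for all $g:S\to\mathbb{C}$. *)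

(* Defs.v *)
From HB Require Import structures.
From mathcomp Require Import all_boot all_order all_algebra.
From mathcomp Require Import complex.
From mathcomp Require Import all_classical all_reals all_analysis.

Set Implicit Arguments.
Unset Strict Implicit.
Unset Printing Implicit Defensive.

Import Order.TTheory GRing.Theory Num.Theory.
Local Open Scope ring_scope.
Local Open Scope classical_set_scope.

Notation cabs := ComplexField.Normc.normc.

Definition nonprincipal_character (R : realType) (F : finFieldType)
    (e : F -> R[i]) : Prop :=
  [/\ forall x, cabs (e x) = 1,
      forall x y, e (x + y) = e x * e y
    & exists x, e x <> 1].

Definition dotp (F : finFieldType) (n : nat) (x y : 'rV[F]_n) : F :=
  \sum_(i < n) x 0 i * y 0 i.

(* The points (xi, xi . xi) of F^(d+1) with xi in F^d. *)
Definition paraboloid (F : finFieldType) (d : nat) : {set 'rV[F]_(d + 1)} :=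
  [set row_mx xi (const_mx (dotp xi xi)) | xi : 'rV[F]_d]%SET.

(* A function on S is represented by a function on the whole of F^n;
   only its values on S are used. *)
Definition extension (R : realType) (F : finFieldType) (n : nat)
    (e : F -> R[i]) (S : {set 'rV[F]_n}) (g : 'rV[F]_n -> R[i])
    (x : 'rV[F]_n) : R[i] :=
  (#|S|%:R)^-1 * \sum_(xi in S) g xi * e (dotp x xi).

(* Lebesgue norms for finite exponents p, q. *)
Definition Lnorm_dsigma (R : realType) (F : finFieldType) (n : nat)
    (S : {set 'rV[F]_n}) (p : R) (g : 'rV[F]_n -> R[i]) : R :=
  ((#|S|%:R)^-1 * \sum_(xi in S) cabs (g xi) `^ p) `^ p^-1.

Definition Lnorm_dx (R : realType) (F : finFieldType) (n : nat)
    (q : R) (f : 'rV[F]_n -> R[i]) : R :=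
  (\sum_(x : 'rV[F]_n) cabs (f x) `^ q) `^ q^-1.

(* The admissible constants form a closed half-line when S is nonempty, so the
   smallest one is their infimum. It is taken in the extended reals: with no
   admissible constant it would be +oo, not a default value. *)
Definition restriction_const (R : realType) (F : finFieldType) (n : nat)
    (e : F -> R[i]) (S : {set 'rV[F]_n}) (p q : R) : \bar R :=
  ereal_inf [set C%:E | C in [set C : R |
    forall g : 'rV[F]_n -> R[i],
      Lnorm_dx q (extension e S g) <= C * Lnorm_dsigma S p g]].

(* Main.v *)
Require Import Defs.
From HB Require Import structures.
From mathcomp Require Import all_boot all_order all_algebra.
From mathcomp Require Import complex.
From mathcomp Require Import all_classical all_reals all_analysis.
From mathcomp Require Import ring lra.
Set Implicit Arguments.
Unset Strict Implicit.
Unset Printing Implicit Defensive.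
Import Order.TTheory GRing.Theory Num.Theory.
Local Open Scope ring_scope.

(** The constant is in fact absolute: R^*(8/5 -> 4) <= 2, and |F|^eps >= 1.

    Expanding the fourth power of the L^4 norm and summing over x by
    orthogonality of characters (lemma l4_le_energy) leaves the quadruples of
    points of S with a + b = c + d.  On the paraboloid such a quadruple is the
    lift of a rectangle of the plane F^2 with diagonals {a, b} and {c, d}
    (lemma lift2_rect), so it remains to bound the sum over all rectangles of
    the product of the values of |g| at the vertices.

    Put u = |g|^(1/5) and r^4 = sum u^8, so that |g|^(8/5) = u^8 and the bound
    to prove is rect_energy u <= 3 r^10, a statement about integral powers
    only.  For u the indicator of a set E of N points it reads
    #rectangles << N^(5/2), and the proof is the weighted form of this
    argument: by Cauchy-Schwarz over one side of the rectangle, the square of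
    the number of rectangles is at most N^2 times the number of pairs of
    rectangles sharing that side.  Call the shared side {c, b}, where b = c + v,
    and let a and a' be the vertices next to c in the two rectangles.  If a and
    a' differ, then c is the foot of the perpendicular from b to the line through
    a and a'; as -1 is not a square the plane has no isotropic line, so the
    foot is determined by (a, a', b), which leaves at most N^3 pairs
    (lemma foot_unique).  The pairs with a = a' give back the number T of
    rectangles, and T^2 <= N^2 (N^3 + T) gives T << N^(5/2).

    To run this with weights without losing logarithms, the weight
    (u_a u_b u_c u_d)^5 is first replaced by the unbalanced weight
    (u_c u_b)^6 (u_a u_d)^4, where {c, b} and {a, d} are opposite sides: the
    arithmetic-geometric mean inequality together with the symmetry exchanging
    opposite sides allows it.  With these exponents Cauchy-Schwarz produces the
    eighth powers of u at the points that are summed independently. *)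

(** * The dot product and right angles in the plane *)

Section Dot.
Variables (F : finFieldType) (n : nat).
Implicit Types x y z : 'rV[F]_n.

Lemma dotpC x y : dotp x y = dotp y x.
Proof. by apply: eq_bigr => i _; rewrite mulrC. Qed.

Lemma dotpDl x y z : dotp (x + y) z = dotp x z + dotp y z.
Proof. by rewrite -big_split; apply: eq_bigr => i _; rewrite mxE mulrDl. Qed.

Lemma dotpNl x y : dotp (- x) y = - dotp x y.
Proof. by rewrite -sumrN; apply: eq_bigr => i _; rewrite mxE mulNr. Qed.

Lemma dotpDr x y z : dotp x (y + z) = dotp x y + dotp x z.
Proof. by rewrite !(dotpC x) dotpDl. Qed.

Lemma dotpNr x y : dotp x (- y) = - dotp x y.
Proof. by rewrite !(dotpC x) dotpNl. Qed.

End Dot.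

Section Plane.
Variable F : finFieldType.
Implicit Types x y v w : 'rV[F]_2.

Lemma dotp2E x y : dotp x y = x 0 0 * y 0 0 + x 0 1 * y 0 1.
Proof.
rewrite /dotp big_ord_recl big_ord_recl big_ord0 addr0.
by congr (_ + x 0 _ * y 0 _); apply/val_inj.
Qed.

(** The determinant of (x, y); its vanishing says that x and y are parallel. *)
Definition cross x y : F := x 0 0 * y 0 1 - x 0 1 * y 0 0.

Lemma rV2_eq0 x : x 0 0 = 0 -> x 0 1 = 0 -> x = 0.
Proof.
move=> x0 x1; apply/rowP => i; rewrite mxE.
case: i => [[|[|//]] Hi]; [rewrite -[RHS]x0|rewrite -[RHS]x1];
  by congr (x 0 _); apply/val_inj.
Qed.

(** The orthogonal of a nonzero vector of the plane is a line. *)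
Lemma cross_perp v x y :
  v != 0 -> dotp v x = 0 -> dotp v y = 0 -> cross x y = 0.
Proof.
rewrite !dotp2E => v0 vx vy.
have e0 : v 0 0 * cross x y = 0.
  rewrite /cross.
  have -> : v 0 0 * (x 0 0 * y 0 1 - x 0 1 * y 0 0)
    = (v 0 0 * x 0 0 + v 0 1 * x 0 1) * y 0 1
      - (v 0 0 * y 0 0 + v 0 1 * y 0 1) * x 0 1 by ring.
  by rewrite vx vy !mul0r subrr.
have e1 : v 0 1 * cross x y = 0.
  rewrite /cross.
  have -> : v 0 1 * (x 0 0 * y 0 1 - x 0 1 * y 0 0)
    = (v 0 0 * y 0 0 + v 0 1 * y 0 1) * x 0 0
      - (v 0 0 * x 0 0 + v 0 1 * x 0 1) * y 0 0 by ring.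
  by rewrite vx vy !mul0r subrr.
apply/eqP; apply: contraT => c0; case/negP: v0; apply/eqP.
by apply: rV2_eq0; apply/eqP; [move/eqP: e0|move/eqP: e1];
  rewrite mulf_eq0 (negbTE c0) orbF.
Qed.

Hypothesis hF : ~ exists x : F, x ^+ 2 = -1.

(** If x_0^2 + x_1^2 = 0 with x_1 nonzero, then x_0 / x_1 squares to -1. *)
Lemma dotp_anisotropic x : dotp x x = 0 -> x = 0.
Proof.
rewrite dotp2E => h; have x1 : x 0 1 = 0.
  apply/eqP; apply: contraT => x1; case: hF; exists (x 0 0 / x 0 1).
  rewrite expr_div_n; apply: (mulIf (expf_neq0 2 x1)).
  rewrite divfK ?expf_neq0 //; apply/eqP; rewrite -subr_eq0 -h.
  by apply/eqP; ring.
apply: rV2_eq0 => //; move: h; rewrite x1 mulr0 addr0 => /eqP.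
by rewrite mulf_eq0 orbb => /eqP.
Qed.

(** Lagrange's identity |k|^2 |x|^2 = (k . x)^2 + (x * k)^2, with the cross
    product in the last term, makes x isotropic. *)
Lemma perp_parallel_eq0 x k : k != 0 -> dotp k x = 0 -> cross x k = 0 -> x = 0.
Proof.
move=> k0 kx xk; apply: dotp_anisotropic; apply/eqP.
have : dotp k k * dotp x x = 0.
  have -> : dotp k k * dotp x x = dotp k x ^+ 2 + cross x k ^+ 2.
    by rewrite !dotp2E /cross; ring.
  by rewrite kx xk expr0n addr0.
move/eqP; rewrite mulf_eq0 => /orP[/eqP/dotp_anisotropic kk|//].
by rewrite kk eqxx in k0.
Qed.

(** The point c is the foot of the perpendicular from c + v to the line through
    c + w and c + w'.  Two such feet differ by a vector d that is orthogonal to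
    the line, because both perpendiculars are, and parallel to it, because both
    feet are on it. *)
Lemma foot_unique c v w w' c2 v2 w2 w2' :
    [&& v != 0, dotp v w == 0, dotp v w' == 0 & w' != w] ->
    [&& v2 != 0, dotp v2 w2 == 0, dotp v2 w2' == 0 & w2' != w2] ->
    c + w = c2 + w2 -> c + w' = c2 + w2' -> c + v = c2 + v2 ->
  [/\ c = c2, v = v2, w = w2 & w' = w2'].
Proof.
move=> /and4P[v0 /eqP vw /eqP vw' ww] /and4P[v20 /eqP vw2 /eqP vw2' ww2] Ew Ew' Ev.
have [d Ed] : exists d, c2 = c + d by exists (c2 - c); rewrite addrC subrK.
rewrite Ed -!addrA in Ew Ew' Ev.
move: Ew Ew' Ev => /addrI Ew /addrI Ew' /addrI Ev.
suff d0 : d = 0 by split; rewrite ?Ed ?Ew ?Ew' ?Ev d0 ?add0r ?addr0.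
have Ek : w2' - w2 = w' - w by rewrite Ew Ew'; apply/rowP => i; rewrite !mxE; ring.
apply: (@perp_parallel_eq0 d (w' - w)); first by rewrite subr_eq0.
- have -> : d = v - v2 by rewrite Ev addrK.
  rewrite dotpDr dotpNr -{2}Ek !(dotpC (_ - _)) !dotpDr !dotpNr.
  by rewrite vw vw' vw2 vw2' !subr0.
- have -> : d = w - w2 by rewrite Ew addrK.
  have h1 : cross w (w' - w) = 0.
    by apply: (cross_perp v0) => //; rewrite dotpDr dotpNr vw vw' subr0.
  have h2 : cross w2 (w' - w) = 0.
    by rewrite -Ek; apply: (cross_perp v20) => //;
      rewrite dotpDr dotpNr vw2 vw2' subr0.
  by rewrite -[0](subrr 0) -{1}h1 -h2 /cross !mxE; ring.
Qed.

End Plane.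

(** * Two inequalities for finite sums *)

Section Sums.
Variable R : realFieldType.

(** From Lagrange's identity: twice the difference of the two sides is the sum
    of the squares (a_i b_j - a_j b_i)^2. *)
Lemma sum_cauchy_schwarz (I : finType) (P : pred I) (a b : I -> R) :
  (\sum_(i | P i) a i * b i) ^+ 2
    <= (\sum_(i | P i) a i ^+ 2) * (\sum_(i | P i) b i ^+ 2).
Proof.
have : 0 <= \sum_(i | P i) \sum_(j | P j) (a i * b j - a j * b i) ^+ 2.
  by apply: sumr_ge0 => i _; apply: sumr_ge0 => j _; exact: sqr_ge0.
have -> : \sum_(i | P i) \sum_(j | P j) (a i * b j - a j * b i) ^+ 2 =
   2 * ((\sum_(i | P i) a i ^+ 2) * (\sum_(i | P i) b i ^+ 2)
       - (\sum_(i | P i) a i * b i) ^+ 2).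
  have -> : 2 * ((\sum_(i | P i) a i ^+ 2) * (\sum_(i | P i) b i ^+ 2)
       - (\sum_(i | P i) a i * b i) ^+ 2) =
     (\sum_(i | P i) a i ^+ 2) * (\sum_(i | P i) b i ^+ 2) +
     (\sum_(i | P i) b i ^+ 2) * (\sum_(i | P i) a i ^+ 2)
     - 2 * ((\sum_(i | P i) a i * b i) * (\sum_(i | P i) a i * b i)) by ring.
  rewrite !big_distrlr /= mulr_sumr -sumrN -!big_split /=.
  apply: eq_bigr => i _; rewrite mulr_sumr -sumrN -!big_split /=.
  by apply: eq_bigr => j _; ring.
by rewrite pmulr_rge0 // subr_ge0.
Qed.

Lemma ler_sum_inj (I J : finType) (P : pred I) (h : I -> J) (f : J -> R) :
  {in P &, injective h} -> (forall j, 0 <= f j) ->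
  \sum_(i | P i) f (h i) <= \sum_j f j.
Proof.
move=> hinj f0.
have -> : \sum_(i | P i) f (h i) = \sum_(i in [set i | P i]) f (h i).
  by apply: eq_bigl => i; rewrite inE.
rewrite -(big_imset f) /=; last by move=> i j; rewrite !inE; apply: hinj.
by rewrite [leRHS](bigID (mem (h @: [set i | P i]))) /= lerDl sumr_ge0.
Qed.

End Sums.

(** * Weighted count of rectangles *)

(** A rectangle with vertex c and side vectors v, w has vertices c, c + v,
    c + w, c + v + w, where v . w = 0. *)

Section Rectangles.
Variables (R : realFieldType) (F : finFieldType).
Hypothesis hF : ~ exists x : F, x ^+ 2 = -1.
Local Notation V := 'rV[F]_2.

(** Exchanging the opposite sides {c, c + v} and {c + w, c + v + w} of each
    rectangle is the change of variables c := c + w, w := - w. *)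
Lemma sum_rect_swap (K : V -> V -> V -> V -> R) (v : V) :
  \sum_(w | dotp v w == 0) \sum_c K c (c + v) (c + w) (c + v + w)
  = \sum_(w | dotp v w == 0) \sum_c K (c + w) (c + v + w) c (c + v).
Proof.
rewrite (reindex_inj oppr_inj) /=.
apply: eq_big => [w|w _]; first by rewrite dotpNr oppr_eq0.
rewrite (reindex_inj (addIr w)) /=; apply: eq_bigr => c _.
by congr K; rewrite ?addrK // addrAC ?addrK.
Qed.

Variables (u : V -> R) (r : R).
Hypothesis u_ge0 : forall x, 0 <= u x.
Hypothesis r_ge0 : 0 <= r.
Hypothesis sum_u8 : \sum_x u x ^+ 8 = r ^+ 4.

Lemma u2_le x : u x ^+ 2 <= r.
Proof.
rewrite -(ler_pXn2r (n := 4)) ?nnegrE ?exprn_ge0 // -exprM -sum_u8.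
by rewrite (bigD1 x) //= lerDl sumr_ge0 // => y _; rewrite exprn_ge0.
Qed.

Lemma sum_double_translates :
  \sum_(v : V) \sum_c (u c * u (c + v)) ^+ 8 = r ^+ 8.
Proof.
rewrite exchange_big /= -[8%N]/(4 + 4)%N exprD -sum_u8 mulr_suml.
apply: eq_bigr => c _; rewrite mulr_sumr [RHS](reindex_inj (addrI c)) /=.
by apply: eq_bigr => v _; rewrite exprMn.
Qed.

(** The three points determine (v, c, w, w') by uniqueness of the foot, so the
    sum over all triples of points, which is (sum u^8)^3, bounds this one. *)
Lemma offdiag_triples :
  \sum_(v : V | v != 0) \sum_c \sum_(w | dotp v w == 0)
     \sum_(w' | (dotp v w' == 0) && (w' != w))
       (u (c + v) * u (c + w) * u (c + w')) ^+ 8 <= r ^+ 12.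
Proof.
pose P (t : V * V * V * V) := [&& t.1.1.1 != 0, dotp t.1.1.1 t.1.2 == 0,
   dotp t.1.1.1 t.2 == 0 & t.2 != t.1.2].
pose h (t : V * V * V * V) : V * V * V :=
  (t.1.1.2 + t.1.1.1, t.1.1.2 + t.1.2, t.1.1.2 + t.2).
pose f (s : V * V * V) := (u s.1.1 * u s.1.2 * u s.2) ^+ 8.
have -> : r ^+ 12 = \sum_s f s.
  rewrite -[12%N]/(4 + 4 + 4)%N !exprD -sum_u8.
  rewrite big_distrlr /= pair_big /= big_distrlr /= pair_big /=.
  by apply: eq_bigr => -[[x y] z] _; rewrite /f /= !exprMn.
have := @ler_sum_inj R _ _ P h f.
set A := \sum_(i | P i) _ => H.
have -> : \sum_(v : V | v != 0) \sum_c \sum_(w | dotp v w == 0)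
     \sum_(w' | (dotp v w' == 0) && (w' != w))
       (u (c + v) * u (c + w) * u (c + w')) ^+ 8 = A.
  rewrite pair_big /= pair_big_dep /= pair_big_dep /= /A.
  by apply: eq_bigl => -[[[v c] w] w']; rewrite /P /= andbT -andbA.
apply: H => [|s]; last first.
  by rewrite /f exprn_ge0 // !mulr_ge0.
move=> [[[v c] w] w'] [[[v2 c2] w2] w2']; rewrite !unfold_in /P /h /= => p1 p2.
case=> Ev Ew Ew'.
by have [-> -> -> ->] := foot_unique hF p1 p2 Ew Ew' Ev.
Qed.

(** The exponents 6 and 4 fit the Cauchy-Schwarz inequality of skew_energy_le.
    With 6 = 4 + 2, the 4 becomes (u c u(c+v))^8 in the first factor, and the 2
    becomes (u c u(c+v))^4 in the second, next to the square of the sum over w of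
    (u(c+w) u(c+v+w))^4.  Expanding that square, all six points have exponent 4;
    their product is the geometric mean of two products of eighth powers at
    three independent points. *)
Definition skew_energy : R := \sum_(v : V | v != 0) \sum_(w | dotp v w == 0)
  \sum_c (u c * u (c + v)) ^+ 6 * (u (c + w) * u (c + v + w)) ^+ 4.

Lemma skew_energy_ge0 : 0 <= skew_energy.
Proof.
by do 3!(apply: sumr_ge0 => ? _); rewrite mulr_ge0 ?exprn_ge0 ?mulr_ge0.
Qed.

(** After the exchange of opposite sides the weight is that of skew_energy times
    (u c)^2 (u(c+v))^2, and u^2 <= r pointwise. *)
Lemma diag_le : \sum_(v : V | v != 0) \sum_(w | dotp v w == 0)
  \sum_c (u c * u (c + v)) ^+ 4 * (u (c + w) * u (c + v + w)) ^+ 8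
  <= r ^+ 2 * skew_energy.
Proof.
rewrite mulr_sumr; apply: ler_sum => v _.
have -> := sum_rect_swap
  (fun x y z t : V => (u x * u y) ^+ 4 * (u z * u t) ^+ 8) v.
rewrite mulr_sumr; apply: ler_sum => w _.
rewrite mulr_sumr; apply: ler_sum => c _.
rewrite mulrC mulrA ler_wpM2r ?exprn_ge0 ?mulr_ge0 //.
rewrite (exprD _ 2 6) ler_wpM2r ?exprn_ge0 ?mulr_ge0 //.
by rewrite exprMn [r ^+ 2]expr2 ler_pM ?exprn_ge0 ?u2_le.
Qed.

(** The six points are c, c + w, c + w' on a line and c + v, c + v + w,
    c + v + w' on a parallel line.  Grouping them as {c + v, c + w, c + w'} and
    {c, c + v + w, c + v + w'} and using xy <= (x^2 + y^2) / 2 gives the sum of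
    offdiag_triples twice, since exchanging the two lines exchanges the
    groups. *)
Lemma offdiag_le : \sum_(v : V | v != 0) \sum_c \sum_(w | dotp v w == 0)
     \sum_(w' | (dotp v w' == 0) && (w' != w))
       (u c * u (c + v)) ^+ 4 * (u (c + w) * u (c + v + w)) ^+ 4
         * (u (c + w') * u (c + v + w')) ^+ 4 <= r ^+ 12.
Proof.
(* Exchange of the two lines: c := c + v, v := - v. *)
have tE : \sum_(v : V | v != 0) \sum_c \sum_(w | dotp v w == 0)
     \sum_(w' | (dotp v w' == 0) && (w' != w))
       (u c * u (c + v + w) * u (c + v + w')) ^+ 8 =
   \sum_(v : V | v != 0) \sum_c \sum_(w | dotp v w == 0)
     \sum_(w' | (dotp v w' == 0) && (w' != w))
       (u (c + v) * u (c + w) * u (c + w')) ^+ 8.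
  rewrite [RHS](reindex_inj oppr_inj) /=.
  apply: eq_big => [v|v _]; first by rewrite oppr_eq0.
  rewrite [RHS](reindex_inj (addIr v)) /=; apply: eq_bigr => c _.
  rewrite addrK; apply: eq_big => [w|w _]; first by rewrite dotpNl oppr_eq0.
  by apply: eq_bigl => w'; rewrite dotpNl oppr_eq0.
apply: (@le_trans _ _ (2^-1 * (r ^+ 12 + r ^+ 12))); last by lra.
have H2 := offdiag_triples; rewrite -tE in H2.
apply: le_trans (ler_wpM2l _ (lerD offdiag_triples H2)); last by lra.
rewrite -big_split mulr_sumr; apply: ler_sum => v _ /=.
rewrite -big_split mulr_sumr; apply: ler_sum => c _ /=.
rewrite -big_split mulr_sumr; apply: ler_sum => w _ /=.
rewrite -big_split mulr_sumr; apply: ler_sum => w' _ /=.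
set x := u (c + v) * u (c + w) * u (c + w').
set y := u c * u (c + v + w) * u (c + v + w').
have -> : (u c * u (c + v)) ^+ 4 * (u (c + w) * u (c + v + w)) ^+ 4
   * (u (c + w') * u (c + v + w')) ^+ 4 = x ^+ 4 * y ^+ 4 by rewrite /x /y; ring.
have : 0 <= (x ^+ 4 - y ^+ 4) ^+ 2 by exact: sqr_ge0.
by rewrite sqrrB -!exprM; lra.
Qed.

(** Cauchy-Schwarz over the sides {c, c + v} gives
    M^2 <= r^8 (r^2 M + r^12) for M = skew_energy, a quadratic inequality
    which bounds M by a multiple of r^10. *)
Lemma skew_energy_le : skew_energy <= 2 * r ^+ 10.
Proof.
pose H v c := \sum_(w | dotp v w == 0) (u (c + w) * u (c + v + w)) ^+ 4.
have ME : skew_energy = \sum_(p : V * V | p.1 != 0)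
   (u p.2 * u (p.2 + p.1)) ^+ 4 * ((u p.2 * u (p.2 + p.1)) ^+ 2 * H p.1 p.2).
  transitivity (\sum_(v | v != 0) \sum_c
    (u c * u (c + v)) ^+ 4 * ((u c * u (c + v)) ^+ 2 * H v c)).
    apply: eq_bigr => v _; rewrite exchange_big /=; apply: eq_bigr => c _.
    by rewrite mulrA -exprD mulr_sumr.
  by rewrite pair_big /=; apply: eq_bigl => p; rewrite andbT.
have CS : skew_energy ^+ 2 <= r ^+ 8 *
    \sum_(v | v != 0) \sum_c (u c * u (c + v)) ^+ 4 * H v c ^+ 2.
  rewrite ME; apply: le_trans (sum_cauchy_schwarz _ _ _) _.
  rewrite [X in _ * X <= _](_ : _ = \sum_(v | v != 0) \sum_c
    (u c * u (c + v)) ^+ 4 * H v c ^+ 2); last first.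
    rewrite pair_big /=; apply: eq_big => [p|p _]; first by rewrite andbT.
    by rewrite exprMn -exprM.
  apply: ler_wpM2r.
    do 2!(apply: sumr_ge0 => ? _).
    by rewrite mulr_ge0 ?sqr_ge0 ?exprn_ge0 ?mulr_ge0.
  rewrite -sum_double_translates pair_big /=.
  rewrite [leRHS](bigID (fun p => p.1 != 0)) /=.
  rewrite (eq_bigr (fun p => (u p.2 * u (p.2 + p.1)) ^+ 8)) => [|p _]; last first.
    by rewrite -exprM.
  by rewrite lerDl sumr_ge0 // => p _; rewrite exprn_ge0 ?mulr_ge0.
(* Expand the square of H over pairs (w, w') and separate w' = w. *)
have split_sq : \sum_(v | v != 0) \sum_c (u c * u (c + v)) ^+ 4 * H v c ^+ 2
    <= r ^+ 2 * skew_energy + r ^+ 12.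
  apply: le_trans (lerD diag_le offdiag_le).
  rewrite -big_split /=; apply: ler_sum => v _.
  rewrite exchange_big -big_split /=; apply: ler_sum => c _.
  rewrite expr2 /H mulr_suml mulr_sumr -big_split /=; apply: ler_sum => w vw.
  rewrite mulr_sumr (bigD1 w) //= -expr2 -exprM mulrDr lerD2l mulr_sumr.
  by apply: ler_sum => w' _; rewrite mulrA.
have M0 := skew_energy_ge0; have R5 : 0 <= r ^+ 10 by rewrite exprn_ge0.
(* If M > 2 r^10 then M^2 > 2 r^10 M >= r^10 M + r^20. *)
rewrite leNgt; apply/negP => lt.
have R2 : 0 <= r ^+ 2 by rewrite exprn_ge0.
have R8 : 0 <= r ^+ 8 by rewrite exprn_ge0.
have {CS split_sq} := le_trans CS (ler_wpM2l R8 split_sq).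
have -> : r ^+ 8 * (r ^+ 2 * skew_energy + r ^+ 12) =
   r ^+ 10 * skew_energy + r ^+ 10 * r ^+ 10 by ring.
by nra.
Qed.

(** The degenerate rectangles v = 0 or w = 0 are included: they occur in the
    expansion of the fourth power. *)
Definition rect_energy : R := \sum_(v : V) \sum_(w | dotp v w == 0)
  \sum_c (u c * u (c + v) * u (c + w) * u (c + v + w)) ^+ 5.

(** The rectangles with v = 0 contribute (sum u^10)^2, at most r^10 because
    u^2 <= r.  For the others, write x and y for the products over two opposite
    sides; then (x y)^5 <= (x^6 y^4 + x^4 y^6) / 2, and the two terms have the
    same sum by exchange of these sides. *)
Lemma rect_energy_le : rect_energy <= 3 * r ^+ 10.
Proof.
rewrite /rect_energy (bigD1 0) //=.
have deg : \sum_(w : V | dotp 0 w == 0)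
    \sum_c (u c * u (c + 0) * u (c + w) * u (c + 0 + w)) ^+ 5 <= r ^+ 10.
  rewrite big_mkcond /= -[10%N]/(2 + 8)%N exprD -sum_double_translates mulr_sumr.
  apply: ler_sum => w _; case: ifP => _; last first.
    rewrite mulr_ge0 ?exprn_ge0 // sumr_ge0 // => c _.
    by rewrite exprn_ge0 ?mulr_ge0.
  rewrite mulr_sumr; apply: ler_sum => c _.
  rewrite addr0 (_ : _ ^+ 5 = (u c ^+ 2 * u (c + w) ^+ 2) *
    (u c * u (c + w)) ^+ 8); last by ring.
  rewrite ler_wpM2r ?exprn_ge0 ?mulr_ge0 // [r ^+ 2]expr2.
  by rewrite ler_pM ?exprn_ge0 ?u2_le.
have nondeg : \sum_(v : V | v != 0) \sum_(w | dotp v w == 0)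
  \sum_c (u c * u (c + v) * u (c + w) * u (c + v + w)) ^+ 5 <= skew_energy.
  apply: ler_sum => v _.
  set A := leRHS.
  have AE : A = 2^-1 * (A + \sum_(w | dotp v w == 0) \sum_c
      (u (c + w) * u (c + v + w)) ^+ 6 * (u c * u (c + v)) ^+ 4).
    have <- := sum_rect_swap
      (fun x y z t : V => (u x * u y) ^+ 6 * (u z * u t) ^+ 4) v.
    by rewrite -/A; field.
  rewrite AE -big_split mulr_sumr; apply: ler_sum => w _ /=.
  rewrite -big_split mulr_sumr; apply: ler_sum => c _ /=.
  set x := u c * _; rewrite -mulrA; set y := u _ * _.
  have x0 : 0 <= x by rewrite mulr_ge0.
  have y0 : 0 <= y by rewrite mulr_ge0.
  have : 0 <= (x * y) ^+ 4 * (x - y) ^+ 2.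
    by rewrite mulr_ge0 ?sqr_ge0 ?exprn_ge0 ?mulr_ge0.
  have -> : (x * y) ^+ 4 * (x - y) ^+ 2 =
    x ^+ 6 * y ^+ 4 + y ^+ 6 * x ^+ 4 - 2 * (x * y) ^+ 5 by ring.
  by lra.
have := lerD deg (le_trans nondeg skew_energy_le); lra.
Qed.

End Rectangles.

(** * The fourth moment of an exponential sum *)

Section Fourier.
Variables (C : numClosedFieldType) (F : finFieldType) (n : nat) (e : F -> C).
Hypothesis e_norm : forall x, `|e x| = 1.
Hypothesis eD : forall x y, e (x + y) = e x * e y.
Hypothesis e_nontriv : exists x, e x <> 1.
Local Notation V := 'rV[F]_n.

Lemma char0 : e 0 = 1.
Proof.
have e00 : e 0 != 0 by rewrite -normr_gt0 e_norm.
by apply: (mulfI e00); rewrite -eD addr0 mulr1.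
Qed.

Lemma char_conj t : (e t)^* = e (- t).
Proof.
have et0 : e t != 0 by rewrite -normr_gt0 e_norm.
by apply: (mulfI et0); rewrite -normCK e_norm expr1n -eD subrr char0.
Qed.

(** For y <> 0 some z has e (z . y) <> 1, and translation by z multiplies the
    sum by this number. *)
Lemma char_sum (y : V) :
  \sum_x e (dotp x y) = if y == 0 then #|F|%:R ^+ n else 0.
Proof.
case: eqVneq => [->|y0].
  rewrite (eq_bigr (fun _ => 1)) => [|x _]; last first.
    by rewrite /dotp big1 ?char0 // => i _; rewrite mxE mulr0.
  by rewrite sumr_const card_mx mul1n natrX.
have [i yi] : exists i, y 0 i != 0 by apply/rV0Pn.
have [t et] := e_nontriv.
pose z : V := (t / y 0 i) *: delta_mx 0 i.
have ez : dotp z y = t.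
  rewrite /dotp (bigD1 i) //= !mxE !eqxx mulr1 divfK // big1 ?addr0 // => j ji.
  by rewrite !mxE (negbTE ji) andbF mulr0 mul0r.
set s := LHS.
have : s = s * e t.
  rewrite {1}/s (reindex_inj (addIr z)) /= mulr_suml; apply: eq_bigr => x _.
  by rewrite dotpDl eD ez.
move/eqP; rewrite -subr_eq0 -{1}[s]mulr1 -mulrBr mulf_eq0 subr_eq0.
by case/orP => /eqP // /esym.
Qed.

(** The fourth power of the modulus of P is P P^* P^* P, whose expansion has
    indices i, k, l, j; the sum over x keeps only the quadruples with
    phi i + phi j = phi k + phi l. *)
Lemma l4_le_energy (I : finType) (phi : I -> V) (g : I -> C) :
  \sum_x `|\sum_i g i * e (dotp x (phi i))| ^+ 4 <=
  #|F|%:R ^+ n * \sum_i \sum_k \sum_l \sum_(j | phi i + phi j == phi k + phi l)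
     `|g i| * `|g k| * `|g l| * `|g j|.
Proof.
have E x : `|\sum_i g i * e (dotp x (phi i))| ^+ 4 =
  \sum_i \sum_k \sum_l \sum_j g i * (g k)^* * (g l)^* * g j *
    e (dotp x (phi i + phi j - (phi k + phi l))).
  rewrite -[4%N]/(2 * 2)%N exprM normCK expr2 {2}[_ * _^*]mulrC rmorph_sum /=.
  rewrite [_ * \sum_i _^*]big_distrlr [_ * \sum_i _ * _]big_distrlr /=.
  rewrite mulr_suml; apply: eq_bigr => i _.
  rewrite mulr_suml; apply: eq_bigr => k _.
  rewrite mulr_sumr; apply: eq_bigr => l _.
  rewrite mulr_sumr; apply: eq_bigr => j _.
  rewrite !rmorphM /= !char_conj -!dotpNr opprD !dotpDr !eD.
  by ring.
set T := leLHS.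
have T0 : 0 <= T by apply: sumr_ge0 => x _; rewrite exprn_ge0.
rewrite -(ger0_norm T0) /T (eq_bigr _ (fun x _ => E x)).
rewrite exchange_big mulr_sumr; apply: le_trans (ler_norm_sum _ _ _) _.
apply: ler_sum => i _.
rewrite exchange_big mulr_sumr; apply: le_trans (ler_norm_sum _ _ _) _.
apply: ler_sum => k _.
rewrite exchange_big mulr_sumr; apply: le_trans (ler_norm_sum _ _ _) _.
apply: ler_sum => l _.
rewrite exchange_big mulr_sumr [leRHS]big_mkcond.
apply: le_trans (ler_norm_sum _ _ _) _.
apply: ler_sum => j _; rewrite -mulr_sumr char_sum subr_eq0.
case: ifP => _; last by rewrite mulr0 normr0.
by rewrite !normrM !norm_conjC normrX normr_nat mulrC.
Qed.

End Fourier.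

(** * Extension from the paraboloid *)

Section Paraboloid.
Variables (R : realType) (F : finFieldType).
Hypothesis hF : ~ exists x : F, x ^+ 2 = -1.
Local Notation V := 'rV[F]_2.

Definition lift2 (x : V) : 'rV[F]_(2 + 1) := row_mx x (const_mx (dotp x x)).

Lemma lift2_inj : injective lift2.
Proof. by move=> x y /eq_row_mx[]. Qed.

(** The last coordinates agree when |c|^2 + |c+v+w|^2 = |c+v|^2 + |c+w|^2, and
    the difference of the two sides is 2 v . w.  Characteristic 2 is excluded by
    hF, because there 1 is a square root of -1. *)
Lemma lift2_rect (c v w z : V) :
  (lift2 c + lift2 z == lift2 (c + v) + lift2 (c + w)) =
  (dotp v w == 0) && (z == c + v + w).
Proof.
have two0 : (2 : F) != 0.
  apply/eqP => h; apply: hF; exists 1; rewrite expr1n.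
  by apply/eqP; rewrite -subr_eq0 opprK -[1 + 1]/2%:R h.
have E : 2 * dotp v w = dotp c c + dotp (c + v + w) (c + v + w)
   - (dotp (c + v) (c + v) + dotp (c + w) (c + w)).
  by rewrite !dotpDl !dotpDr (dotpC v c) (dotpC w c) (dotpC w v); ring.
have perpE : (dotp v w == 0) = (dotp c c + dotp (c + v + w) (c + v + w) ==
     dotp (c + v) (c + v) + dotp (c + w) (c + w)).
  by rewrite -[RHS]subr_eq0 -E mulf_eq0 (negbTE two0).
rewrite /lift2 !add_row_mx; apply/eqP/idP => [/eq_row_mx[h1 h2]|].
  have zE : z = c + v + w.
    by apply: (addrI c); rewrite h1; apply/rowP => i; rewrite !mxE; ring.
  by rewrite zE eqxx andbT perpE -zE; move/matrixP/(_ 0 0): h2; rewrite !mxE => ->.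
case/andP => /[swap] /eqP->; rewrite perpE => /eqP h; congr row_mx.
  by apply/rowP => i; rewrite !mxE; ring.
by apply/matrixP => i j; rewrite !mxE.
Qed.

Lemma energy_rect (u : V -> R) :
  \sum_i \sum_k \sum_l \sum_(j | lift2 i + lift2 j == lift2 k + lift2 l)
     u i ^+ 5 * u k ^+ 5 * u l ^+ 5 * u j ^+ 5 = rect_energy u.
Proof.
rewrite /rect_energy.
under [RHS]eq_bigr do rewrite exchange_big.
rewrite [RHS]exchange_big /=; apply: eq_bigr => c _.
rewrite (reindex_inj (addrI c)) /=; apply: eq_bigr => v _.
rewrite (reindex_inj (addrI c)) /= [RHS]big_mkcond; apply: eq_bigr => w _.
rewrite (eq_bigl _ _ (lift2_rect c v w)).
case: ifP => _ /=; last by rewrite big_pred0_eq.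
by rewrite big_pred1_eq; ring.
Qed.

Lemma card_paraboloid : #|paraboloid F 2| = (#|F| ^ 2)%N.
Proof. by rewrite (card_imset _ lift2_inj) card_mx mul1n. Qed.

Lemma sum_paraboloid (T : nmodType) (h : 'rV[F]_(2 + 1) -> T) :
  \sum_(x in paraboloid F 2) h x = \sum_x h (lift2 x).
Proof. by rewrite (big_imset _ (in2W lift2_inj)). Qed.

Lemma normc_norm (z : R[i]) : `|z| = (cabs z)%:C%C.
Proof. by []. Qed.

Lemma powR_root (x : R) (m : nat) : 0 <= x -> (x `^ m.+1%:R^-1) ^+ m.+1 = x.
Proof.
move=> x0; rewrite -powR_mulrn ?powR_ge0 // -powRrM mulVf ?pnatr_eq0 //.
by rewrite powRr1.
Qed.

Variables (e : F -> R[i]) (g : 'rV[F]_(2 + 1) -> R[i]).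
Hypothesis he : nonprincipal_character e.

(** The bound of l4_le_energy, whose moduli are elements of R[i], as an
    inequality between real numbers. *)
Lemma l4_energy_cabs :
  \sum_x cabs (\sum_(y : V) g (lift2 y) * e (dotp x (lift2 y))) ^+ 4 <=
  #|F|%:R ^+ 3 * \sum_i \sum_k \sum_l
     \sum_(j | lift2 i + lift2 j == lift2 k + lift2 l)
     cabs (g (lift2 i)) * cabs (g (lift2 k)) * cabs (g (lift2 l))
       * cabs (g (lift2 j)).
Proof.
have [e1 eD e_nontriv] := he.
have en x : `|e x| = 1 by rewrite normc_norm e1.
have := l4_le_energy en eD e_nontriv lift2 (fun y => g (lift2 y)).
rewrite -lecR rmorph_sum.
rewrite rmorphM rmorphXn rmorph_nat rmorph_sum /=.
under [X in _ -> X <= _]eq_bigr do rewrite rmorphXn /= -normc_norm.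
move=> h; apply: le_trans h _.
rewrite le_eqVlt; apply/orP; left; apply/eqP; congr (_ * _).
apply: eq_bigr => i _; rewrite rmorph_sum /=.
apply: eq_bigr => k _; rewrite rmorph_sum /=.
apply: eq_bigr => l _; rewrite rmorph_sum /=.
by apply: eq_bigr => j _; rewrite -!normrM normc_norm !Normc.normcM.
Qed.

(** With q = |F| and #|S| = q^2, the fourth power of the right-hand norm is
    (r^2 / q)^5 and that of the left-hand norm is at most
    q^-8 q^3 rect_energy u <= 3 (r^2 / q)^5; finally 3 <= 2^4. *)
Lemma extension_estimate :
  Lnorm_dx 4 (extension e (paraboloid F 2) g)
    <= 2 * Lnorm_dsigma (paraboloid F 2) (8 / 5) g.
Proof.
pose G (x : V) : R := cabs (g (lift2 x)).
have cabs_ge0 (z : R[i]) : 0 <= cabs z by case: z => a b; exact: sqrtr_ge0.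
pose u x := G x `^ 5^-1.
have u0 x : 0 <= u x by exact: powR_ge0.
have u5 x : u x ^+ 5 = G x by apply: (powR_root 4); exact: cabs_ge0.
have u8 x : u x ^+ 8 = G x `^ (8 / 5).
  by rewrite -powR_mulrn // -powRrM [5^-1 * _]mulrC.
pose A := \sum_x u x ^+ 8.
have A0 : 0 <= A by apply: sumr_ge0 => x _; rewrite exprn_ge0.
pose r := A `^ 4^-1.
have r0 : 0 <= r by exact: powR_ge0.
have r4 : A = r ^+ 4 by rewrite powR_root.
pose q : R := #|F|%:R.
have q0 : 0 < q by rewrite ltr0n; apply/card_gt0P; exists 0.
have sigmaE : Lnorm_dsigma (paraboloid F 2) (8 / 5) g ^+ 4 = (r ^+ 2 / q) ^+ 5.
  rewrite /Lnorm_dsigma card_paraboloid natrX -/q sum_paraboloid.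
  rewrite (_ : \sum_x _ = r ^+ 4); last first.
    by rewrite -r4; apply: eq_bigr => x _; rewrite u8.
  have -> : (q ^+ 2)^-1 * r ^+ 4 = (r ^+ 2 / q) ^+ 2 by field; rewrite gt_eqF.
  have x0 : 0 <= r ^+ 2 / q by rewrite divr_ge0 ?exprn_ge0 // ltW.
  move: (r ^+ 2 / q) x0 => x x0.
  rewrite -!powR_mulrn ?powR_ge0 // -!powRrM; congr (_ `^ _).
  by field.
have dxE : Lnorm_dx 4 (extension e (paraboloid F 2) g) ^+ 4 =
    q ^- 8 * \sum_x cabs (\sum_(y : V) g (lift2 y) * e (dotp x (lift2 y))) ^+ 4.
  rewrite /Lnorm_dx powR_root; last by apply: sumr_ge0 => x _; exact: powR_ge0.
  rewrite mulr_sumr; apply: eq_bigr => x _.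
  rewrite powR_mulrn // /extension card_paraboloid sum_paraboloid.
  rewrite Normc.normcM Normc.normcV exprMn; congr (_ * _).
  have -> : cabs (#|F| ^ 2)%:R = q ^+ 2 :> R.
    by apply: complexI; rewrite -normc_norm normr_nat natrX rmorphXn rmorph_nat.
  by rewrite exprVn -exprM.
have key : Lnorm_dx 4 (extension e (paraboloid F 2) g) ^+ 4
    <= 3 * Lnorm_dsigma (paraboloid F 2) (8 / 5) g ^+ 4.
  rewrite dxE sigmaE.
  apply: le_trans (ler_wpM2l _ l4_energy_cabs) _.
    by rewrite invr_ge0 exprn_ge0 ?ltW.
  rewrite (_ : 3 * _ = q ^- 8 * (q ^+ 3 * (3 * r ^+ 10))); last first.
    by field; rewrite gt_eqF.
  apply: ler_wpM2l; first by rewrite invr_ge0 exprn_ge0 ?ltW.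
  apply: ler_wpM2l; first by rewrite exprn_ge0 ?ltW.
  rewrite -[leLHS](_ : rect_energy u = _); last first.
    rewrite -energy_rect; do 4!(apply: eq_bigr => ? _).
    by rewrite !u5.
  exact: rect_energy_le.
rewrite -(ler_pXn2r (n := 4)) ?nnegrE ?mulr_ge0 ?powR_ge0 //.
apply: le_trans key _; rewrite exprMn ler_wpM2r ?exprn_ge0 ?powR_ge0 //.
by rewrite -natrX ler_nat.
Qed.

End Paraboloid.

Theorem proposition5p2 (R : realType) (eps : R) (heps : 0 < eps) :
  exists C : R,
    forall (F : finFieldType) (p : nat) (hp : p \in [pchar F]) (hp2 : (2 < p)%N)
      (hF : ~ exists x : F, x ^+ 2 = -1)
      (e : F -> R[i]) (he : nonprincipal_character e),
      (restriction_const e (paraboloid F 2) (8 / 5) 4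
         <= (C * #|F|%:R `^ eps)%:E)%E.
Proof.
exists 2 => F p _ _ hF e he; apply: ge_ereal_inf; exists 2%:E.
  by exists 2 => // g; apply: extension_estimate.
rewrite lee_fin ler_peMr // -[leLHS](powRr0 #|F|%:R).
apply: ler_powR; last exact: ltW.
by rewrite ler1n; apply/card_gt0P; exists 0.
Qed.
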